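(* Let $\phi = \frac{1+\sqrt{5}}{2}$ and let $M(n)$ denote the maximal length of a play of the ordered Zeckendorf game on $n$. Then $$M(n) = \frac{n^2}{2} - \Theta(n\log_\phi(n));$$ that is, there exist constants $c_1, c_2 > 0$ and an integer $N$ such that for all integers $n \ge N$, $$c_1\, n\log_\phi(n) \le \frac{n^2}{2} - M(n) \le c_2\, n\log_\phi(n).$$
   Context: The Fibonacci numbers are indexed by $F_1 = 1$, $F_2 = 2$, and $F_{i+1} = F_i + F_{i-1}$ for $i \ge 2$. The (two-player) ordered Zeckendorf game on $n$: a state is a finite ordered list (tuple) of Fibonacci numbers. The initial state is the list $(F_1, F_1, \dots, F_1)$ of $n$ copies of $F_1$. Players alternate turns; on each turn the player performs one of the following legal moves on two adjacent entries of the list (the other entries and their order being unchanged): (1) Merging: replace an adjacent pair $(F_i, F_{i+1})$ with the single entry $F_{i+2}$. (2) Merging ones: replace an adjacent pair $(F_1, F_1)$ with the single entry $F_2$. (3) Splitting: replace an adjacent pair $(F_i, F_i)$ with $(F_{i-2}, F_{i+1})$, for $i > 2$. (4) Splitting twos: replace an adjacent pair $(F_2, F_2)$ with $(F_1, F_3)$. (5) Switching: replace an adjacent pair $(F_i, F_j)$ with $(F_j, F_i)$ whenever $i > j$. The game ends when no legal move can be applied. The length of a play is the total number of moves made (by both players together). *)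

(* Defs.v *)
(* Developed on top of MathComp and MathComp-Analysis. *)
From HB Require Import structures.
From mathcomp Require Import all_boot all_order all_algebra.
From mathcomp Require Import reals exp.

Set Implicit Arguments.
Unset Strict Implicit.
Unset Printing Implicit Defensive.

(* F_1 = 1, F_2 = 2, F_{i+1} = F_i + F_{i-1}.  The value fib 0 = 1 is junk
   that merely extends the recurrence: every use below has a positive index. *)
Fixpoint fib (n : nat) : nat :=
  match n with
  | 0 => 1
  | n'.+1 => match n' with
             | 0 => 1
             | n''.+1 => fib n' + fib n''
             end
  end.

(* A state lists the Fibonacci numbers themselves, not their indices; the two
   are interchangeable since fib is injective on positive indices. *)
Definition state := seq nat.

Inductive move : state -> state -> Prop :=
| Merge (l r : state) (i : nat) : 1 <= i ->
    move (l ++ [:: fib i; fib i.+1] ++ r) (l ++ [:: fib i.+2] ++ r)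
| MergeOnes (l r : state) :
    move (l ++ [:: fib 1; fib 1] ++ r) (l ++ [:: fib 2] ++ r)
| Split (l r : state) (i : nat) : 2 < i ->
    move (l ++ [:: fib i; fib i] ++ r) (l ++ [:: fib (i - 2); fib i.+1] ++ r)
| SplitTwos (l r : state) :
    move (l ++ [:: fib 2; fib 2] ++ r) (l ++ [:: fib 1; fib 3] ++ r)
| Switch (l r : state) (i j : nat) : 1 <= j -> j < i ->
    move (l ++ [:: fib i; fib j] ++ r) (l ++ [:: fib j; fib i] ++ r).

Definition initial (n : nat) : state := nseq n (fib 1).

Definition game_over (s : state) : Prop := forall t : state, ~ move s t.

(* play s k: some play from s runs until no legal move is left and consists
   of exactly k moves. *)
Inductive play : state -> nat -> Prop :=
| play_over (s : state) : game_over s -> play s 0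
| play_step (s t : state) (k : nat) : move s t -> play t k -> play s k.+1.

Definition is_max_play_length (n m : nat) : Prop :=
  play (initial n) m /\ forall k : nat, play (initial n) k -> k <= m.

Local Open Scope ring_scope.

Definition phi (R : realType) : R := (1 + Num.sqrt 5) / 2.

Definition log_base (R : realType) (b x : R) : R := ln x / ln b.

(* Main.v *)
Require Import Defs.
From mathcomp Require Import all_boot all_order all_algebra.
From mathcomp Require Import reals exp.
From mathcomp Require Import boolp.
From mathcomp Require Import zify lra.

Set Implicit Arguments.
Unset Strict Implicit.
Unset Printing Implicit Defensive.

(** Weigh each ordered pair of entries of a state by its left entry; the total
is [moment].  It equals 'C(n, 2) on n ones, and every move lowers it by at
least 1: a switch of F_i and F_j lowers it by F_i - F_j, a split of two F_i by
F_i - F_{i-2}, a merge of F_i with F_{i+1} by F_i plus the sum of the entries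
standing to the left.  So no play is longer than n(n-1)/2, and the two halves
of the corollary ask how much of this budget has to be wasted by moves that
lower the moment by more than 1.

The waste is measured by [elevation], the sum of F_i (i - 3) over the entries
F_i with i > 3, which is 0 at the start and of order n log n once the mass n
sits in entries of index about log_phi n.

Upper bound on M(n).  The elevation gained in a move is at most 8 times the
waste of that move ([move_cost]), so 8 * moment + elevation decreases by at
least 8 in each move.  A final state is strictly increasing, hence its largest
entry F_k carries a fixed fraction of n, with k >= log_phi n - 2, and its
elevation is at least a constant times n log_phi n.

Lower bound on M(n).  Some plays waste little: call a run of moves thrifty if
each of them wastes at most the elevation that it gains.  Start from ones
followed by a strictly increasing list of larger entries.  Merge the two
leftmost ones, where no entry on the left adds to the loss, and let the resulting F_2
walk to the right over all remaining ones; this wastes nothing.  It may meet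
another F_2; then splits carry upwards, as in binary addition, until the list
is strictly increasing again ([thrifty_carry]).  Each round shortens the
state, and all is thrifty, so one ends in a strictly increasing state, which
has O(log n) entries, each of index O(log n).  There moment and elevation are
both O(n log n), so the whole run has at least 'C(n, 2) - O(n log n) moves. *)

(** * Fibonacci numbers *)

Local Arguments fib : simpl never.

Lemma fibSS i : fib i.+2 = fib i.+1 + fib i.
Proof. by []. Qed.

Lemma fib_gt0 i : 0 < fib i.
Proof.
suff: 0 < fib i /\ 0 < fib i.+1 by case.
by elim: i => [//|i [IH1 IH2]]; split=> //; rewrite fibSS addn_gt0 IH2.
Qed.

Lemma fib_mono i j : i <= j -> fib i <= fib j.
Proof.
apply: (homo_leq leqnn leq_trans) => -[//|k].
by rewrite fibSS leq_addr.
Qed.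

Lemma fib_incr i j : 0 < i -> i < j -> fib i < fib j.
Proof.
case: i => // i _ /fib_mono; apply: leq_trans.
by rewrite fibSS -addn1 leq_add2l fib_gt0.
Qed.

Lemma leq_fib i : i <= fib i.
Proof.
case: i => // i; elim: i => // i IH.
by rewrite (leq_ltn_trans IH) ?fib_incr.
Qed.

Lemma fibS_le2 i : fib i.+1 <= 2 * fib i.
Proof. by case: i => // i; rewrite fibSS mul2n -addnn leq_add2l fib_mono. Qed.

Lemma fib_inj i j : 0 < i -> 0 < j -> fib i = fib j -> i = j.
Proof.
move=> i0 j0 eij; case: (ltngtP i j) => // [/(fib_incr i0)|/(fib_incr j0)];
by rewrite eij ltnn.
Qed.

(** States hold values rather than indices, so indices have to be recovered:
this inverts [fib] on positive indices, the bound x on the search being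
sufficient by [leq_fib]. *)
Definition fib_index (x : nat) : nat :=
  (index x (mkseq (fun i => fib i.+1) x)).+1.

Lemma fibK i : 0 < i -> fib_index (fib i) = i.
Proof.
case: i => // i _; rewrite /fib_index; congr _.+1.
have ltif : i < fib i.+1 by exact: leq_fib.
rewrite -{1}(nth_mkseq 0 (fun i => fib i.+1) ltif) index_uniq ?size_mkseq //.
by apply/mkseq_uniqP => a b _ _ /fib_inj-/(_ isT isT)[].
Qed.

Definition is_fib (x : nat) : bool := fib (fib_index x) == x.

Lemma is_fib_fib i : 0 < i -> is_fib (fib i).
Proof. by move=> i0; rewrite /is_fib fibK. Qed.

(** * Two potentials on states *)

Fixpoint moment (s : state) : nat :=
  if s is x :: s' then x * size s' + moment s' else 0.

(** The offset 3, truncated at 0, makes the moves on small entries free: the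
merges of F_1 with F_1 or with F_2 and the split of two F_2 may lower the
moment by exactly 1, and then they must not gain any elevation. *)
Definition elevation (s : state) : nat := \sum_(x <- s) x * (fib_index x - 3).

Lemma moment_cat s t : moment (s ++ t) = moment s + sumn s * size t + moment t.
Proof.
elim: s => [//|x s IH] /=.
by rewrite IH size_cat mulnDr mulnDl; lia.
Qed.

Lemma elevation_cat s t : elevation (s ++ t) = elevation s + elevation t.
Proof. exact: big_cat. Qed.

Lemma elevation1 i : 0 < i -> elevation [:: fib i] = fib i * (i - 3).
Proof. by move=> i0; rewrite /elevation big_seq1 fibK. Qed.

Lemma elevation2 i j : 0 < i -> 0 < j ->
  elevation [:: fib i; fib j] = fib i * (i - 3) + fib j * (j - 3).
Proof. by move=> i0 j0; rewrite -cat1s elevation_cat !elevation1. Qed.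

Lemma moment_replace l u v r : sumn u = sumn v -> size v <= size u ->
  moment (l ++ v ++ r) + moment u <= moment (l ++ u ++ r) + moment v.
Proof.
move=> suv lvu; rewrite !moment_cat !size_cat suv.
have := leq_mul (leqnn (sumn l)) lvu; rewrite !mulnDr; lia.
Qed.

Lemma moment_replace_eq l u v r : sumn u = sumn v -> size v = size u ->
  moment (l ++ v ++ r) + moment u = moment (l ++ u ++ r) + moment v.
Proof.
by move=> suv lvu; rewrite !moment_cat !size_cat suv lvu; lia.
Qed.

Lemma elevation_replace l u v r :
  elevation (l ++ v ++ r) + elevation u = elevation (l ++ u ++ r) + elevation v.
Proof. by rewrite !elevation_cat; lia. Qed.

(** * Every move pays for the elevation it gains *)

Lemma fib_split i : 2 < i -> fib (i - 2) + fib i.+1 = fib i + fib i.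
Proof. by case: i => [|[|[|i]]] // _; rewrite !subSS subn0 !fibSS; lia. Qed.

Lemma move_sumn s t : move s t -> sumn t = sumn s.
Proof.
case=> [l r i _|l r|l r i i2|l r|l r i j _ _]; rewrite !sumn_cat /=;
  [rewrite fibSS|by []|have := fib_split i2|by []|]; lia.
Qed.

Lemma move_is_fib s t : move s t -> all is_fib s -> all is_fib t.
Proof.
case=> [l r i i0|l r|l r i i2|l r|l r i j i0 ij];
  rewrite !all_cat => /and3P[-> _ ->]; rewrite /= ?is_fib_fib //; lia.
Qed.

(** For i > 2 the gain is 2 F_i + F_{i+1} <= 4 F_i, which is at most
8 (F_i - 1) because F_i >= 2; this is where the factor 8 comes from. *)
Lemma merge_elevation i : 0 < i ->
  fib i.+2 * (i.+2 - 3) + 8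
    <= fib i * (i - 3) + fib i.+1 * (i.+1 - 3) + 8 * fib i.
Proof.
case: i => [|[|[|i]]] // _.
have := fibS_le2 i.+3; have : 2 <= fib i.+3 by exact: (@fib_mono 2).
rewrite [fib i.+4.+1]fibSS !subSS !subn0; move: (fib _) (fib _) => f g.
lia.
Qed.

(** For i > 4 the gain is F_{i+1} - 2 F_{i-2} = 2 F_{i-1} - F_{i-2}, while the
waste is F_{i-1} - 1. *)
Lemma split_elevation i : 2 < i ->
  fib (i - 2) * (i - 2 - 3) + fib i.+1 * (i.+1 - 3) + 8 * fib (i - 2) + 8
    <= fib i * (i - 3) + fib i * (i - 3) + 8 * fib i.
Proof.
case: i => [|[|[|[|[|i]]]]] // _.
have : 2 <= fib i.+4 by exact: (@fib_mono 2).
rewrite !subSS !subn0 [fib i.+2.+4]fibSS [fib i.+1.+4]fibSS.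
move: (fib _) (fib _) => f g; lia.
Qed.

(** The reverse comparison: 2 F_{i-1} - F_{i-2} >= F_{i-1}, so a split wastes
no more than the elevation it gains. *)
Lemma split_elevation_ge i : 2 < i ->
  fib i * (i - 3) + fib i * (i - 3) + fib i
    <= fib (i - 2) * (i - 2 - 3) + fib i.+1 * (i.+1 - 3) + fib (i - 2) + 1.
Proof.
case: i => [|[|[|[|[|i]]]]] // _.
have : fib i.+3 <= fib i.+4 by rewrite fib_mono.
rewrite !subSS !subn0 [fib i.+2.+4]fibSS [fib i.+1.+4]fibSS.
move: (fib _) (fib _) => f g; lia.
Qed.

Lemma move_cost s t : move s t ->
  8 * moment t + elevation t + 8 <= 8 * moment s + elevation s.
Proof.
have cost l u v r : sumn u = sumn v -> size v <= size u ->
    8 * moment v + elevation v + 8 <= 8 * moment u + elevation u ->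
    8 * moment (l ++ v ++ r) + elevation (l ++ v ++ r) + 8
      <= 8 * moment (l ++ u ++ r) + elevation (l ++ u ++ r).
  move=> suv lvu; have := moment_replace l r suv lvu.
  have := elevation_replace l u v r; lia.
case=> [l r i i0|l r|l r i i2|l r|l r i j j0 ij]; apply: cost => //.
- by rewrite /= fibSS; lia.
- rewrite elevation1 // elevation2 // ![moment _]/=.
  by have := merge_elevation i0; lia.
- by rewrite elevation2 // elevation1.
- by have := fib_split i2; rewrite /=; lia.
- rewrite !elevation2 ?subn_gt0 //; try lia; rewrite ![moment _]/=.
  by have := split_elevation i2; lia.
- by rewrite !elevation2.
- by rewrite /=; lia.
- have i0 := leq_trans j0 (ltnW ij).
  by rewrite !elevation2 // ![moment _]/=; have := fib_incr j0 ij; lia.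
Qed.

(** * Plays terminate, and a longest one exists *)

Lemma exists_play s : exists k, play s k.
Proof.
have [n] := ubnP (8 * moment s + elevation s).
elim: n s => // n IH s sn.
case: (pselect (game_over s)) => [gs|/existsNP[t /contrapT st]].
  by exists 0; constructor.
have := move_cost st => cst.
have [|k pk] := IH t; first by lia.
by exists k.+1; apply: play_step pk.
Qed.

Lemma play_cost s k : play s k -> all is_fib s ->
  exists t, [/\ game_over t, all is_fib t, sumn t = sumn s &
    8 * moment t + elevation t + 8 * k <= 8 * moment s + elevation s].
Proof.
elim=> [{}s gs fs|{}s t {}k st _ IH fs]; first by exists s; split=> //; lia.
have [u [gu fu su cu]] := IH (move_is_fib st fs).
exists u; split=> //; first by rewrite su (move_sumn st).
by have := move_cost st; lia.
Qed.

Lemma is_fib_initial n : all is_fib (initial n).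
Proof. by apply/allP => x /nseqP[-> _]; rewrite is_fib_fib. Qed.

Lemma exists_max_play_length n : exists m, is_max_play_length n m.
Proof.
have exP : exists k, `[< play (initial n) k >].
  by have [k pk] := exists_play (initial n); exists k; apply/asboolP.
have ubP k : `[< play (initial n) k >] ->
    k <= 8 * moment (initial n) + elevation (initial n).
  move=> /asboolP pk.
  by have [t [_ _ _]] := play_cost pk (is_fib_initial n); lia.
have [m /asboolP pm maxm] := ex_maxnP exP ubP.
by exists m; split=> // k pk; apply: maxm; apply/asboolP.
Qed.

(** * Final states are high *)

Lemma sorted_adjacent s :
  (forall l x y r, s = l ++ [:: x; y] ++ r -> x < y) -> sorted ltn s.
Proof.
case: s => //= x s; elim: s x => //= y s IH x adj.
rewrite (adj [::] x y s) //=; apply: IH => l a b r e.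
by apply: (adj (x :: l) a b r); rewrite e.
Qed.

(** A descent could be switched and a repetition could be merged or split. *)
Lemma game_over_sorted s : game_over s -> all is_fib s -> sorted ltn s.
Proof.
move=> gs fs; apply: sorted_adjacent => l x y r es.
move: gs fs; rewrite {}es !all_cat => gs /and3P[_ /and3P[/eqP ex /eqP ey _] _].
move: gs; rewrite -{}ex -{}ey.
have: 0 < fib_index x by []. have: 0 < fib_index y by [].
move: (fib_index x) (fib_index y) => i j j0 i0 gs.
case: (ltngtP i j) => [|ji|eij]; first exact: fib_incr.
  by case: (gs _ (Switch _ _ _ ji)).
move: gs; rewrite {}eij; case: j j0 => // -[_|[_|j _]] gs.
- by case: (gs _ (MergeOnes _ _)).
- by case: (gs _ (SplitTwos _ _)).
- by case: (gs _ (@Defs.Split _ _ j.+3 isT)).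
Qed.

(** Telescoping: F_1 + ... + F_{k-1} = F_{k+1} - 2. *)
Lemma sumn_sorted_fib k s : 0 < k -> sorted ltn s ->
  all (fun x => is_fib x && (x < fib k)) s -> sumn s + 2 <= fib k.+1.
Proof.
rewrite (sorted_pairwise ltn_trans).
elim/last_ind: s k => [|s x IH] k k0; first by move=> _ _; apply: (@fib_mono 2).
rewrite pairwise_rcons all_rcons sumn_rcons => /andP[lt_sx srt].
move=> /andP[/andP[/eqP fx xk] fs].
have {}IH : sumn s + 2 <= fib (fib_index x).+1.
  apply: IH => //; rewrite fx.
  by apply/allP => y ys; rewrite (allP lt_sx) // andbT; have /andP[] := allP fs y ys.
have lt_xk : fib_index x < k.
  by rewrite ltnNge; apply/negP => /fib_mono; rewrite fx leqNgt xk.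
have := fib_mono (lt_xk : (fib_index x).+2 <= k.+1); rewrite fibSS fx; lia.
Qed.

(** Here F_k is the largest entry of s. *)
Lemma elevation_sorted s : sorted ltn s -> all is_fib s -> 0 < sumn s ->
  exists k, sumn s <= fib k.+2 /\ fib k * (k - 3) <= elevation s.
Proof.
case/lastP: s => // s x srt; rewrite all_rcons => /andP[fx fs] _.
exists (fib_index x); split; last first.
  by rewrite (eqP fx) /elevation -cats1 big_cat big_seq1 leq_addl.
suff : sumn (rcons s x) + 2 <= fib (fib_index x).+2 by lia.
apply: sumn_sorted_fib => //; move: srt.
rewrite (sorted_pairwise ltn_trans) pairwise_rcons => /andP[lt_sx _].
have ltx : x < fib (fib_index x).+1 by rewrite -{1}(eqP fx) fib_incr.
rewrite all_rcons fx ltx; apply/allP => y ys.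
by rewrite (allP fs) //= (ltn_trans _ ltx) // (allP lt_sx).
Qed.

Lemma moment_initial n : moment (initial n) = 'C(n, 2).
Proof.
elim: n => // n IH.
by rewrite [initial _]/= [moment _]/= IH size_nseq mul1n binS bin1 addnC.
Qed.

Lemma elevation_initial n : elevation (initial n) = 0.
Proof. by rewrite /elevation big1_seq // => x /andP[_ /nseqP[-> _]]. Qed.

Lemma sumn_initial n : sumn (initial n) = n.
Proof. by rewrite /initial sumn_nseq mul1n. Qed.

Lemma play_upper n k : 0 < n -> play (initial n) k ->
  exists j, n <= fib j.+2 /\ 8 * k + fib j * (j - 3) <= 8 * 'C(n, 2).
Proof.
move=> n0 /play_cost/(_ (is_fib_initial n))[t [gt ft st]].
rewrite moment_initial elevation_initial => ct.
rewrite sumn_initial in st.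
have [|j [nj hj]] := elevation_sorted (game_over_sorted gt ft) ft.
  by rewrite st.
by exists j; rewrite -{1}st; split=> //; lia.
Qed.

(** * Thrifty runs *)

(** Each move lowers moment + elevation by at most 1: summed up, the number of
moves is at least the total drop of moment + elevation. *)
Inductive thrifty : state -> state -> Prop :=
| thrifty_refl s : thrifty s s
| thrifty_step s t u : move s t ->
    moment s + elevation s <= moment t + elevation t + 1 ->
    thrifty t u -> thrifty s u.

Lemma thrifty_trans t s u : thrifty s t -> thrifty t u -> thrifty s u.
Proof.
by move=> st tu; elim: st tu => // a b c ab cab _ IH /IH; apply: thrifty_step.
Qed.

Lemma thrifty_move l u v r : move (l ++ u ++ r) (l ++ v ++ r) ->
  sumn u = sumn v -> size v = size u ->
  moment u + elevation u <= moment v + elevation v + 1 ->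
  thrifty (l ++ u ++ r) (l ++ v ++ r).
Proof.
move=> muv suv lvu cuv; apply: thrifty_step muv _ (thrifty_refl _).
have := moment_replace_eq l r suv lvu; have := elevation_replace l u v r; lia.
Qed.

Lemma thrifty_play s t : thrifty s t ->
  exists2 k, play s k & moment s + elevation s <= moment t + elevation t + k.
Proof.
elim=> [{}s|{}s {}t u st cst _ [k pk ck]].
  by have [k pk] := exists_play s; exists k => //; lia.
by exists k.+1; [apply: play_step pk | lia].
Qed.

Lemma thrifty_sumn s t : thrifty s t -> sumn t = sumn s.
Proof. by elim=> // a b c /move_sumn<-. Qed.

Lemma thrifty_walk l m r :
  thrifty (l ++ fib 2 :: nseq m (fib 1) ++ r) (l ++ nseq m (fib 1) ++ fib 2 :: r).
Proof.
elim: m l => [|m IH] l; first exact: thrifty_refl.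
apply: (@thrifty_trans (l ++ [:: fib 1; fib 2] ++ nseq m (fib 1) ++ r)).
  apply: (@thrifty_move l [:: fib 2; fib 1]) => //; first exact: Switch.
  by rewrite !elevation2.
by have := IH (rcons l (fib 1)); rewrite !cat_rcons.
Qed.

(** The merge takes place at the left end because a merge also costs the sum of
the entries to its left. *)
Lemma thrifty_ones m r :
  thrifty (nseq m.+2 (fib 1) ++ r) (nseq m (fib 1) ++ fib 2 :: r).
Proof.
apply: thrifty_trans (thrifty_walk [::] m r).
apply: thrifty_step (MergeOnes [::] _) _ (thrifty_refl _).
move: (nseq m (fib 1) ++ r) => t; rewrite !cat0s !moment_cat !elevation_cat.
rewrite elevation1 // elevation2 //.
have -> : fib 1 = 1 by [].
have -> : fib 2 = 2 by [].
by rewrite /=; lia.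
Qed.

Lemma thrifty_split l i r : 2 < i ->
  thrifty (l ++ [:: fib i; fib i] ++ r) (l ++ [:: fib (i - 2); fib i.+1] ++ r).
Proof.
move=> i2; apply: thrifty_move => //; first exact: Defs.Split.
  by rewrite /= !addn0 fib_split.
rewrite !elevation2 ?subn_gt0 //; try lia.
rewrite ![moment _]/=; have := split_elevation_ge i2; lia.
Qed.

(** * Carrying *)

Definition canonical (m : nat) (R : seq nat) : state :=
  map fib (nseq m 1 ++ R).

Lemma canonicalS m R : canonical m.+1 R = canonical m (1 :: R).
Proof. by rewrite /canonical -addn1 nseqD -catA. Qed.

(** The carry c is to be inserted between the entries L below and R above.  If
R starts with c, split the two copies into c - 2 and c + 1, and go on with the
carry c + 1.  The gap between c and L is what makes c - 2 a new entry, already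
in its place: along the carry, the indices c - 1 and c - 2 are missing because
the previous two splits have used them up, so neither a repetition nor a switch
arises below c.  The gap persists, c - 2 being less than (c + 1) - 2. *)
Lemma thrifty_carry m L c R :
  path ltn 1 (L ++ [:: c]) -> all (fun a => a + 2 < c) L ->
  path ltn c.-1 R ->
  exists m' R', [/\ path ltn 1 R', m' + size R' = m + (size L + (size R).+1) &
    thrifty (canonical m (L ++ c :: R)) (canonical m' R')].
Proof.
elim: R m L c => [|d R IH] m L c pL Lc pR.
  by exists m, (L ++ [:: c]); split=> //; [rewrite size_cat | apply: thrifty_refl].
have [c1 sL] : 1 < c /\ path ltn 1 L.
  move: pL; rewrite cat_path /= andbT => /andP[sL lc]; split=> //.
  apply: leq_ltn_trans lc; case: (L) sL => // a L'.
  by move=> /(order_path_min ltn_trans)/allP/(_ _ (mem_last _ _))/ltnW.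
move: pR => /= /andP[cd pR].
have le_cd : c <= d by lia.
case: (ltngtP c d) le_cd => // [lt_cd|eq_cd] _.
  exists m, (L ++ [:: c, d & R]); split; [|by rewrite size_cat|exact: thrifty_refl].
  by rewrite -cat1s catA cat_path pL last_cat /= lt_cd.
rewrite -{d cd}eq_cd in pR *; have pR' : path ltn c.+1.-1 R by [].
(* For c = 2 and c = 3 the entry c - 2 is replaced by 1, which joins the
   leading ones. *)
have [c2|c2|c2] := ltngtP c 3.
- have {}c2 : c = 2 by lia.
  have L0 : L = [::].
    case: (L) sL Lc => //= a ? /andP[a1 _] /andP[ac _]; lia.
  have pc : path ltn 1 ([::] ++ [:: c.+1]) by rewrite /= andbT ltnS ltnW.
  have [m' [R' [pR1 sz th]]] := IH m.+1 [::] c.+1 pc isT pR'.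
  exists m', R'; split=> //; first by rewrite sz L0 /=; lia.
  apply: thrifty_trans th; rewrite L0 c2 canonicalS /canonical !map_cat.
  apply: (@thrifty_move _ [:: fib 2; fib 2] [:: fib 1; fib 3]) => //.
    exact: SplitTwos.
  by rewrite !elevation2.
- have L' : path ltn 1 ((L ++ [:: c - 2]) ++ [:: c.+1]).
    rewrite -catA cat_path sL /= andbT; apply/andP; split; last by lia.
    case/lastP: (L) Lc => [|L1 a] /=; first by lia.
    by rewrite all_rcons last_rcons => /andP[]; lia.
  have Lc' : all (fun a => a + 2 < c.+1) (L ++ [:: c - 2]).
    rewrite all_cat /= andbT; apply/andP; split; last by lia.
    by apply: sub_all Lc => a; lia.
  have [m' [R' [pR1 sz th]]] := IH m (L ++ [:: c - 2]) c.+1 L' Lc' pR'.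
  exists m', R'; split=> //; first by rewrite sz size_cat /=; lia.
  apply: thrifty_trans th; rewrite /canonical !map_cat !catA.
  by rewrite -[X in thrifty _ X]catA; apply: (@thrifty_split _ c); apply: ltnW.
- have L0 : L = [::].
    case: (L) sL Lc => //= a ? /andP[a1 _] /andP[ac _]; lia.
  have pc : path ltn 1 ([::] ++ [:: c.+1]) by rewrite c2.
  have [m' [R' [pR1 sz th]]] := IH m.+1 [::] c.+1 pc isT pR'.
  exists m', R'; split=> //; first by rewrite sz L0 /=; lia.
  apply: thrifty_trans th; rewrite L0 c2 canonicalS /canonical !map_cat.
  exact: (@thrifty_split _ 3).
Qed.

(** Each round merges two ones into a 2 and carries, which leaves the state one
entry shorter. *)
Lemma thrifty_canonical m R : path ltn 1 R ->
  exists u, [/\ sorted ltn u, all (leq 1) u & thrifty (canonical m R) (map fib u)].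
Proof.
have [n] := ubnP (m + size R); elim: n m R => // n IH [|[|m]] R lt_n pR.
- exists R; split; [exact: path_sorted pR| |exact: thrifty_refl].
  by apply: sub_all (order_path_min ltn_trans pR) => a /ltnW.
- exists (1 :: R); split=> //=; last exact: thrifty_refl.
  by apply: sub_all (order_path_min ltn_trans pR) => a /ltnW.
have [//|//|//|m' [R' [pR' sz th]]] := @thrifty_carry m [::] 2 R.
have lt_n' : m' + size R' < n by rewrite sz /=; lia.
have [u [su pu thu]] := IH m' R' lt_n' pR'.
exists u; split=> //; apply: thrifty_trans thu; apply: thrifty_trans th.
rewrite /canonical !map_cat !map_nseq; exact: thrifty_ones.
Qed.

(** * A long play *)

Lemma exists_fib_floor n : 0 < n ->
  exists2 K, fib K <= n & forall a, fib a <= n -> a <= K.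
Proof.
move=> n0; have exP : exists a, fib a <= n by exists 0.
have ubP a : fib a <= n -> a <= n by apply: leq_trans (leq_fib a).
by have [K] := ex_maxnP exP ubP; exists K.
Qed.

Lemma moment_le s : moment s <= sumn s * size s.
Proof.
elim: s => //= x s IH; rewrite mulnDl leq_add ?leq_mul //.
by rewrite (leq_trans IH) // leq_mul.
Qed.

Lemma leq_sumn x (s : seq nat) : x \in s -> x <= sumn s.
Proof.
elim: s => //= y s IH; rewrite inE => /predU1P[->|/IH]; first exact: leq_addr.
by move=> xs; rewrite (leq_trans xs) ?leq_addl.
Qed.

Lemma elevation_le u K : all (leq 1) u -> all (geq K) u ->
  elevation (map fib u) <= sumn (map fib u) * K.
Proof.
rewrite /elevation; elim: u => [|a u IH] /=; first by rewrite big_nil.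
move=> /andP[a1 u1] /andP[aK uK]; rewrite big_cons mulnDl leq_add ?IH //.
by rewrite fibK // leq_mul // (leq_trans (leq_subr _ _)).
Qed.

Lemma play_lower n : 0 < n ->
  exists k K, [/\ play (initial n) k, fib K <= n & 'C(n, 2) <= k + 2 * n * K].
Proof.
move=> n0; have [K Kn Kmax] := exists_fib_floor n0.
have [//|u [su pu]] := @thrifty_canonical n [::].
rewrite /canonical cats0 map_nseq => th.
have [k pk] := thrifty_play th; rewrite moment_initial elevation_initial => ck.
have sumu : sumn (map fib u) = n by rewrite (thrifty_sumn th) sumn_initial.
have uK : all (geq K) u.
  by apply/allP => a au; apply: Kmax; rewrite -sumu leq_sumn ?map_f.
have szu : size u <= K.
  rewrite -[K](size_iota 1); apply: uniq_leq_size.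
    exact: (sorted_uniq ltn_trans ltnn su).
  by move=> a au; rewrite mem_iota (allP pu) //= add1n ltnS; apply: (allP uK).
exists k, K; split=> //.
have := elevation_le pu uK; have := moment_le (map fib u).
rewrite sumu size_map; have : n * size u <= n * K by rewrite leq_mul.
lia.
Qed.

(** * Passage to logarithms *)

Import Order.TTheory GRing.Theory Num.Theory.
Local Open Scope ring_scope.

Lemma phi_sqr (R : realType) : phi R ^+ 2 = phi R + 1.
Proof.
have s5 : Num.sqrt 5 ^+ 2 = 5 :> R by rewrite sqr_sqrtr.
rewrite /phi; move: (Num.sqrt _) s5 => s s5; lra.
Qed.

Lemma phi_expSS (R : realType) k : phi R ^+ k.+2 = phi R ^+ k.+1 + phi R ^+ k.
Proof. by rewrite -addn2 exprD phi_sqr mulrDr mulr1 -exprSr. Qed.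

Lemma phi_gt1 (R : realType) : 1 < phi R.
Proof.
have s5 : 1 < Num.sqrt 5 :> R by rewrite -[ltLHS]sqrtr1 ltr_sqrt //; lra.
rewrite /phi; lra.
Qed.

Lemma phi_le2 (R : realType) : phi R <= 2.
Proof. by have := phi_sqr R; have := phi_gt1 R; nra. Qed.

Lemma fib_ge_phi (R : realType) k : phi R ^+ k <= (fib k.+1)%:R.
Proof.
suff [] : phi R ^+ k <= (fib k.+1)%:R /\ phi R ^+ k.+1 <= (fib k.+2)%:R by [].
elim: k => [|k [IH1 IH2]]; first by rewrite expr0 expr1; split=> //; exact: phi_le2.
by split=> //; rewrite fibSS natrD phi_expSS lerD.
Qed.

Lemma fib_le_phi (R : realType) k : (fib k)%:R <= phi R ^+ k.
Proof.
suff [] : (fib k)%:R <= phi R ^+ k /\ (fib k.+1)%:R <= phi R ^+ k.+1 by [].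
elim: k => [|k [IH1 IH2]]; first by split=> //; exact: ltW (phi_gt1 R).
by split=> //; rewrite fibSS natrD phi_expSS lerD.
Qed.

Lemma log_phi_ge (R : realType) k (x : R) :
  phi R ^+ k <= x -> k%:R <= log_base (phi R) x.
Proof.
have p0 : 0 < phi R by rewrite (lt_trans _ (phi_gt1 R)).
move=> kx; rewrite /log_base ler_pdivlMr ?ln_gt0 ?phi_gt1 //.
rewrite mulr_natl -lnXn // ler_ln ?posrE ?exprn_gt0 //.
by rewrite (lt_le_trans _ kx) ?exprn_gt0.
Qed.

Lemma log_phi_le (R : realType) k (x : R) :
  0 < x -> x <= phi R ^+ k -> log_base (phi R) x <= k%:R.
Proof.
have p0 : 0 < phi R by rewrite (lt_trans _ (phi_gt1 R)).
move=> x0 xk; rewrite /log_base ler_pdivrMr ?ln_gt0 ?phi_gt1 //.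
by rewrite mulr_natl -lnXn // ler_ln ?posrE ?exprn_gt0.
Qed.

Lemma natr_bin2 (R : realType) n : 'C(n, 2)%:R = n%:R ^+ 2 / 2 - n%:R / 2 :> R.
Proof.
case: n => [|n]; first by rewrite expr0n mul0r subr0.
have /(congr1 (fun m => m%:R : R)) := mul_bin_diag n.+1 1.
rewrite bin1 /= !natrM -natr1; lra.
Qed.

Lemma play_upper_real (R : realType) n k : (1024 <= n)%N -> play (initial n) k ->
  48^-1 * (n%:R * log_base (phi R) n%:R) <= n%:R ^+ 2 / 2 - k%:R.
Proof.
move=> n1024 /(play_upper (leq_trans _ n1024))-/(_ isT)[j [nj kj]].
have n0 : 0 < n%:R :> R by rewrite ltr0n (leq_trans _ n1024).
set x := log_base _ _.
(* As phi <= 2 and n >= 2 ^ 10; then x - 5, a lower bound for j - 3, is at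
   least x / 2. *)
have x10 : 10 <= x.
  apply: (@log_phi_ge _ 10); apply: (@le_trans _ _ (2 ^+ 10)).
    by rewrite lerXn2r ?nnegrE ?phi_le2 // ltW // (lt_trans _ (phi_gt1 R)).
  by rewrite -natrX ler_nat.
have xj : x <= j%:R + 2.
  rewrite -natrD addn2; apply: log_phi_le => //.
  by apply: le_trans (fib_le_phi R _); rewrite ler_nat.
have nF : n%:R <= 3 * (fib j)%:R :> R.
  rewrite -natrM ler_nat (leq_trans nj) // fibSS.
  by have := fibS_le2 j; lia.
have hj : j%:R - 3 <= (j - 3)%:R :> R by rewrite lerBlDr -natrD ler_nat; lia.
have {}kj : 8 * k%:R + (fib j)%:R * (j - 3)%:R <= 8 * 'C(n, 2)%:R :> R.
  by rewrite -!natrM -natrD ler_nat.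
have nx : n%:R / 3 * (x / 2) <= (fib j)%:R * (j - 3)%:R.
  by apply: ler_pM; lra.
rewrite natr_bin2 in kj; lra.
Qed.

Lemma play_lower_real (R : realType) n : (2 <= n)%N ->
  exists2 k, play (initial n) k &
    n%:R ^+ 2 / 2 - k%:R <= 5 * (n%:R * log_base (phi R) n%:R).
Proof.
move=> n2; have [|k [K [pk Kn kK]]] := @play_lower n; first exact: ltnW.
exists k => //; set x := log_base _ _.
have n0 : 0 < n%:R :> R by rewrite ltr0n ltnW.
have x1 : 1 <= x.
  by apply: (@log_phi_ge _ 1); rewrite expr1 (le_trans (phi_le2 R)) // ler_nat.
have Kx : K%:R <= x + 1.
  case: K Kn {kK} => [_|K Kn]; first by lra.
  rewrite -natr1 lerD2r; apply: log_phi_ge.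
  by rewrite (le_trans (fib_ge_phi R K)) // ler_nat.
have {}kK : 'C(n, 2)%:R <= k%:R + 2 * n%:R * K%:R :> R.
  by rewrite -!natrM -natrD ler_nat.
have nK : n%:R * K%:R <= n%:R * (x + 1) by rewrite ler_pM2l.
have nx : n%:R * 1 <= n%:R * x by rewrite ler_pM2l.
rewrite natr_bin2 in kK; lra.
Qed.

Theorem corollary1p12 (R : realType) :
  exists M : nat -> nat,
    (forall n : nat, is_max_play_length n (M n)) /\
    (exists c1 c2 : R, exists N : nat,
      [/\ 0 < c1, 0 < c2 &
       forall n : nat, (N <= n)%N ->
         c1 * (n%:R * log_base (phi R) n%:R) <= n%:R ^+ 2 / 2 - (M n)%:R /\
         n%:R ^+ 2 / 2 - (M n)%:R <= c2 * (n%:R * log_base (phi R) n%:R)]).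
Proof.
have [M maxM] := choice exists_max_play_length; exists M; split=> //.
exists 48^-1, 5, 1024; split; rewrite ?invr_gt0 ?ltr0n // => n n1024.
have [pM leM] := maxM n.
split; first exact: play_upper_real.
have [|k pk] := @play_lower_real R n; first exact: leq_trans n1024.
by apply: le_trans; rewrite lerB // ler_nat leM.
Qed.
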